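(* Let $N \in \mathbb{N}$. The map $\mathsf{mag}\colon \mathrm{Cmp}_+(\ell_1^N) \to \mathbb{R}$ is continuous (with respect to the Hausdorff metric on $\mathrm{Cmp}_+(\ell_1^N)$) at every skew element. In more detail, for every non-empty skew compact (therefore finite) subset $F \subseteq \ell_1^N$ we have \[\lim_{r \searrow 0} \mathsf{mag}\big(\overline{C}_F(r)\big) = \mathsf{mag}(F),\] and $\mathsf{mag}$ is continuous at $F$.
   Context: $\mathbb{N}$ includes $0$. $\ell_1^N$ is $\mathbb{R}^N$ with the metric $d_1(x,y) = \sum_{k=1}^N |x_k - y_k|$; all subsets carry this metric. $\mathrm{Cmp}_+(\ell_1^N)$ is the set of non-empty compact subsets of $\ell_1^N$ with the Hausdorff metric. Magnitude: $\ell_1^N$ is positive definite, i.e. for every finite $F \subseteq \ell_1^N$ the similarity matrix $Z_F = (e^{-d_1(p,q)})_{p,q \in F}$ is positive definite; for such $F$, $\mathsf{mag}(F)$ is the sum of the components of the vector $w$ solving $Z_F w = (1,\dots,1)^T$. For compact $K \subseteq \ell_1^N$, $\mathsf{mag}(K) := \sup\{\mathsf{mag}(F) : F \subseteq K \text{ finite}\}$, which is known to be finite and to agree with the previous definition when $K$ is finite. Skewness: for $S \subseteq \mathbb{R}^N$, $\mathrm{skew}(S) := \inf\{|a_k - b_k| : a,b \in S,\ a \neq b,\ 1 \leq k \leq N\}$, with $\mathrm{skew}(S) := \infty$ if $S$ is empty or a singleton. $S$ is skew when $\mathrm{skew}(S) > 0$. Cubes: for $p \in \mathbb{R}^N$ and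 $r \geq 0$, $\overline{C}_p(r) := \prod_{k=1}^N [p_k - r, p_k + r]$, and for finite $F$, $\overline{C}_F(r) := \bigcup_{p \in F} \overline{C}_p(r)$ (with the metric $d_1$). *)

(* Defs.v *)
From HB Require Import structures.
From mathcomp Require Import all_boot all_order all_algebra.
From mathcomp Require Import finmap.
From mathcomp Require Import all_classical all_reals all_analysis.

Set Implicit Arguments.
Unset Strict Implicit.
Unset Printing Implicit Defensive.
Import Order.TTheory GRing.Theory Num.Theory.
Import numFieldNormedType.Exports.
Local Open Scope classical_set_scope.
Local Open Scope ring_scope.

Section Hausdorff.
Context {R : realType} {X : metricType R}.
Implicit Types (A B C : set X) (x y : X).

Definition dist_to B x : R := inf [set mdist x b | b in B].

Definition hausdorff_dist A B : R :=
  Num.max (sup [set dist_to B a | a in A]) (sup [set dist_to A b | b in B]).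

(* Cmp_+(X), identified with its underlying sets; see [CmpE]. *)
Record Cmp := MkCmp {
  Cmp_set :> set X ;
  Cmp_neq0 : Cmp_set !=set0 ;
  Cmp_compact : compact Cmp_set }.

HB.instance Definition _ := gen_eqMixin Cmp.
HB.instance Definition _ := gen_choiceMixin Cmp.

Lemma CmpE (A B : Cmp) : A = B :> set X -> A = B.
Proof.
case: A B => A A0 cA [B B0 cB] /= AB; move: A0 cA B0 cB; rewrite AB => *.
by congr MkCmp; exact: Prop_irrelevance.
Qed.

Lemma dist_to_has_inf B x : B !=set0 -> has_inf [set mdist x b | b in B].
Proof.
move=> [b Bb]; split; first by exists (mdist x b), b.
by exists 0 => _ [c _ <-]; exact: mdist_ge0.
Qed.

Lemma dist_to_le B x b : B b -> dist_to B x <= mdist x b.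
Proof.
move=> Bb; apply: ge_inf; last by exists b.
by apply: (dist_to_has_inf x _).2; exists b.
Qed.

Lemma le_dist_to B x (e : R) : B !=set0 ->
  (forall b, B b -> e <= mdist x b) -> e <= dist_to B x.
Proof.
move=> B0 h; apply: lb_le_inf; first exact: (dist_to_has_inf x B0).1.
by move=> _ [b Bb <-]; exact: h.
Qed.

Lemma compact_mdist_bounded A x : compact A ->
  exists M : R, forall a, A a -> mdist x a <= M.
Proof.
move=> cA; have cf : continuous (fun a : X => mdist x a : R).
  move=> a; apply/(@cvgrPdist_lt R R^o) => e e0.
  have := nbhsx_ballx a e e0; rewrite ballEmdist.
  apply: filterS => b /= abe.
  rewrite ltr_norml ltrBlDr ltrBrDr; apply/andP; split.
    rewrite addrC ltrBlDr; apply: le_lt_trans (metric_triangle x a b) _.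
    by rewrite ltrD2l.
  apply: le_lt_trans (metric_triangle x b a) _.
  by rewrite addrC ltrD2r metric_sym.
have /compact_bounded : compact ((fun a : X => mdist x a : R) @` A).
  by apply: continuous_compact => //; exact: continuous_subspaceT.
move=> [M [_ /(_ (M + 1) (ltr_pwDr ltr01 (lexx _))) h]].
exists (M + 1) => a Aa; apply: le_trans (ler_norm _) _.
by apply: h; exists a.
Qed.

Lemma dist_to_has_sup (A B : Cmp) : has_sup [set dist_to B a | a in A].
Proof.
have [a Aa] := Cmp_neq0 A; have [b Bb] := Cmp_neq0 B.
split; first by exists (dist_to B a), a.
have [M hM] := compact_mdist_bounded b (@Cmp_compact A).
exists M => _ [c Ac <-]; apply: le_trans (dist_to_le c Bb) _.
by rewrite metric_sym; exact: hM.
Qed.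

Lemma hausdorff_distC A B : hausdorff_dist A B = hausdorff_dist B A.
Proof. by rewrite /hausdorff_dist maxC. Qed.

Lemma dist_to_le_hausdorff (A B : Cmp) a : Cmp_set A a ->
  dist_to B a <= hausdorff_dist A B.
Proof.
move=> Aa; rewrite /hausdorff_dist le_max; apply/orP; left.
by apply: ub_le_sup; [exact: (dist_to_has_sup A B).2 | exists a].
Qed.

Lemma hausdorff_dist_le (A B : Cmp) (e : R) :
  (forall a, Cmp_set A a -> dist_to B a <= e) ->
  (forall b, Cmp_set B b -> dist_to A b <= e) ->
  hausdorff_dist A B <= e.
Proof.
move=> h1 h2; rewrite /hausdorff_dist ge_max; apply/andP; split.
  apply: ge_sup; first exact: (dist_to_has_sup A B).1.
  by move=> _ [a Aa <-]; exact: h1.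
apply: ge_sup; first exact: (dist_to_has_sup B A).1.
by move=> _ [b Bb <-]; exact: h2.
Qed.

Lemma dist_to_ge0 (B : Cmp) x : 0 <= dist_to B x.
Proof.
by apply: le_dist_to => [|b _]; [exact: Cmp_neq0 | exact: mdist_ge0].
Qed.

Lemma dist_to_self B x : B x -> dist_to B x <= 0.
Proof. by move=> Bx; rewrite -(mdistxx x); exact: dist_to_le. Qed.

Lemma hausdorff_distxx (A : Cmp) : hausdorff_dist A A = 0.
Proof.
apply/eqP; rewrite eq_le; apply/andP; split.
  by apply: hausdorff_dist_le => a; exact: dist_to_self.
have [a Aa] := Cmp_neq0 A.
exact: le_trans (dist_to_ge0 A a) (dist_to_le_hausdorff _ Aa).
Qed.

Lemma hausdorff_dist_sub (A B : Cmp) :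
  hausdorff_dist A B = 0 -> A `<=` (B : set X).
Proof.
move=> AB0 a Aa.
have /closure_id -> := compact_closed (@metric_hausdorff R X) (@Cmp_compact B).
move=> V; rewrite -(@metricType_numDomainType.nbhs_nbhs_mdist R X).
move=> [e /= e0 aeV]; apply/set0P/eqP => BV0.
have : e <= dist_to B a.
  apply: le_dist_to; first exact: Cmp_neq0.
  move=> b Bb; rewrite leNgt; apply/negP => abe.
  by have : set0 b by rewrite -BV0; split=> //; exact: aeV.
apply/negP; rewrite -ltNge; apply: le_lt_trans e0.
by rewrite -AB0; exact: dist_to_le_hausdorff.
Qed.

Lemma hausdorff_dist_positivity (A B : Cmp) : hausdorff_dist A B = 0 -> A = B.
Proof.
move=> AB0; apply/CmpE/seteqP; split; first exact: hausdorff_dist_sub.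
by apply: hausdorff_dist_sub; rewrite hausdorff_distC.
Qed.

Lemma dist_to_triangle (A B C : Cmp) a : Cmp_set A a ->
  dist_to C a <= hausdorff_dist A B + hausdorff_dist B C.
Proof.
move=> Aa; rewrite -lerBlDr; apply: le_trans (dist_to_le_hausdorff B Aa).
apply: le_dist_to; first exact: Cmp_neq0.
move=> b Bb; rewrite lerBlDr -lerBlDl.
apply: le_trans (dist_to_le_hausdorff C Bb).
apply: le_dist_to; first exact: Cmp_neq0.
move=> c Cc; rewrite lerBlDl; apply: le_trans (metric_triangle a b c).
exact: dist_to_le.
Qed.

Lemma hausdorff_dist_triangle (B A C : Cmp) :
  hausdorff_dist A C <= hausdorff_dist A B + hausdorff_dist B C.
Proof.
apply: hausdorff_dist_le => [a Aa|c Cc]; first exact: dist_to_triangle.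
rewrite addrC (hausdorff_distC A) (hausdorff_distC B).
exact: dist_to_triangle.
Qed.

HB.instance Definition _ := @isMetric.Build R Cmp
  (fun A B : Cmp => hausdorff_dist A B) hausdorff_distxx
  hausdorff_dist_positivity (fun A B : Cmp => hausdorff_distC A B)
  hausdorff_dist_triangle.

End Hausdorff.
Arguments Cmp {R} X.

Section Magnitude.
Context {R : realType} {X : metricType R}.

Definition sim_mx (F : {fset X}) : 'M[R]_#|` F| :=
  \matrix_(i, j) expR (- mdist (tnth (in_tuple F) i) (tnth (in_tuple F) j)).

(* [invmx] inverts only invertible matrices; in a positive definite space,
   such as [l1 R N] below, every [sim_mx F] is invertible, so that [weighting F]
   is the unique [w] with [sim_mx F *m w = const_mx 1]. *)
Definition weighting (F : {fset X}) : 'cV[R]_#|` F| :=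
  invmx (sim_mx F) *m const_mx 1.

Definition fmag (F : {fset X}) : R := \sum_i weighting F i 0.

(* A real supremum: the set is nonempty (it contains [fmag fset0]), and it is
   bounded above when [X] is [l1 R N] and [K] is compact. *)
Definition mag (K : set X) : R :=
  sup [set fmag F | F in [set F : {fset X} | [set` F] `<=` K]].

End Magnitude.

Section L1.
Context {R : realType} {N : nat}.
Implicit Types x y z : 'rV[R]_N.

Definition d1 x y : R := \sum_(k < N) `|x 0 k - y 0 k|.

Lemma d1xx x : d1 x x = 0.
Proof. by rewrite /d1 big1// => k _; rewrite subrr normr0. Qed.

Lemma d1_positivity x y : d1 x y = 0 -> x = y.
Proof.
move=> /eqP; rewrite psumr_eq0// => /allP xy; apply/rowP => k.
by apply/eqP; rewrite -subr_eq0 -normr_eq0; apply: xy; rewrite mem_index_enum.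
Qed.

Lemma d1_sym x y : d1 x y = d1 y x.
Proof. by apply: eq_bigr => k _; rewrite distrC. Qed.

Lemma d1_triangle y x z : d1 x z <= d1 x y + d1 y z.
Proof. by rewrite /d1 -big_split/=; apply: ler_sum => k _; exact: ler_distD. Qed.

End L1.

(* An alias, because ['rV[R]_N] already carries the sup metric. *)
Definition l1 (R : realType) (N : nat) : Type := 'rV[R]_N.

HB.instance Definition _ (R : realType) (N : nat) :=
  Choice.copy (l1 R N) 'rV[R]_N.
HB.instance Definition _ (R : realType) (N : nat) :=
  @isMetric.Build R (l1 R N) (@d1 R N) d1xx d1_positivity d1_sym d1_triangle.

Section Skew.
Context {R : realType} {N : nat}.
Implicit Types (S : set (l1 R N)) (p : 'rV[R]_N).

(* The infimum of the empty set is [+oo], which covers the convention for [S]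
   empty or a singleton. *)
Definition skewness S : \bar R :=
  ereal_inf [set e | exists (a b : 'rV[R]_N) (k : 'I_N),
    [/\ S a, S b, a != b & e = `|a 0 k - b 0 k|%:E]].

Definition skew_set S : Prop := (0 < skewness S)%E.

Definition cube p (r : R) : set (l1 R N) :=
  [set x : 'rV[R]_N | forall k, p 0 k - r <= x 0 k <= p 0 k + r].

Definition cubes S (r : R) : set (l1 R N) := \bigcup_(p in S) cube p r.

End Skew.

(* Main.v *)
Require Import Defs.
From mathcomp Require Import all_boot all_order all_algebra.
From mathcomp Require Import finmap.
From mathcomp Require Import all_classical all_reals all_analysis.
From mathcomp Require Import ring lra.
Import Order.TTheory GRing.Theory Num.Theory.
Import numFieldNormedType.Exports.
Local Open Scope classical_set_scope.
Local Open Scope ring_scope.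

Set Implicit Arguments.
Unset Strict Implicit.
Unset Printing Implicit Defensive.

(** Magnitude on [l1 R N] is controlled by finite signed measures: for weights
[c i] at points [x i], the potential at [y] is [\sum_i c i * simK y (x i)],
where [simK x y] is the exponential of minus the [d1]-distance.  The kernel is
positive definite, being a product over the coordinates of the kernels
[expR (- `|a - b|)] on the line, each of which is a positive combination of
squares; so, by Cauchy-Schwarz, a measure whose potential is [1] on its own
support and on a finite set [G] has total mass at least [fmag G]
([fmag_le_mass]), with equality when it is supported in [G] ([fmag_mass]).

If the Hausdorff distance from [F] to [K] is less than [r], then [K] lies in
[cubes F r].  Both limits thus follow from an upper bound on [fmag G], valid for
all finite [G] in [cubes F r] and tending to [mag F] as [r] tends to [0], and
from a lower bound on [mag K] tending to [mag F] as [K] tends to [F].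

For the upper bound ([fmag_cubes_le], [fmag_cubes_bound]), let [F] consist of
points [p q].  Skewness says that for small [r] the projections of the cubes to
each axis are disjoint intervals.  Seen from the cube around [p t], the kernel
at a point of another cube, around [p q], is then a multiple of one fixed
function, the product over [k] of the exponentials of [+- (x_k - p t_k)], the
sign being that of [p q_k - p t_k].  So on each cube only finitely many
functions occur as potentials: the constant [1], and one such product for every
[q != t].  Each of them is itself the potential of a product measure on the
cube: the constant comes from the weightings of the intervals, of mass at most
[1 + 2 * r], and the exponentials come from point masses [expR r] at the ends of
the intervals ([interval_measure]).  Asking that a combination of these
measures, with coefficients [b t q], has potential [1] on all cubes is a linear
system for [b] whose matrix depends only on [r].  At [r = 0] it says that
[b t t = 1] and that the sums [\sum_q b t q] are the weights of [F], so it is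
uniquely solvable, and the total mass is [mag F]; by continuity of matrix
inversion it is solvable for small [r], with total mass close to [mag F].

For the lower bound ([fmag_lower]), each point of [F] is replaced by a nearby
point of [K]; the weights and the magnitude of the resulting configuration
depend continuously on the points, again by continuity of matrix inversion. *)

(** * Positive definiteness of the exponential kernel *)

Section PositiveDefinite.
Context {R : realType}.
Implicit Types (a b c : R) (s : seq R).

(** The [g t] are the increments of [f] along [s], and the sum telescopes; the
value [c], below all values of [f] on [s], serves for the induction, where it is
the value of [f] at the preceding point. *)
Lemma increments_of_sorted (f : R -> R) s c :
  {homo f : x y / x < y} -> sorted <%R s -> (forall y, y \in s -> c < f y) ->
  exists2 g : R -> R, (forall t, t \in s -> 0 < g t) &
    forall a, a \in s -> \sum_(t <- s) g t * (t <= a)%R%:R = f a - c.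
Proof.
move=> fmono; elim: s c => [|x s IH] c /=; first by exists (fun=> 0).
move=> xs cs.
have xlt y : y \in s -> x < y.
  by move: y; apply/allP; apply: order_path_min xs; exact: lt_trans.
have [g g0 gs] := IH (f x) (path_sorted xs) (fun y ys => fmono _ _ (xlt y ys)).
have xNs : x \notin s by apply/negP => /xlt; rewrite ltxx.
exists (fun t => if t == x then f x - c else g t).
  move=> t; rewrite inE; case: eqP => [-> _|_ /= /g0//].
  by rewrite subr_gt0 cs// mem_head.
have sumE a : \sum_(t <- s) (if t == x then f x - c else g t) * (t <= a)%R%:R =
    \sum_(t <- s) g t * (t <= a)%R%:R.
  by apply: eq_big_seq => t ts; case: eqP ts xNs => [-> ->|].
move=> a; rewrite inE big_cons eqxx sumE => /predU1P[->|as_].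
  rewrite lexx mulr1 big_seq big1 ?addr0// => t ts.
  by rewrite leNgt xlt// mulr0.
by rewrite (ltW (xlt _ as_)) mulr1 gs//; ring.
Qed.

(** Since [- `|a - b| = - a - b + 2 * minr a b], this is the decomposition of
[expR (2 * minr a b)] as the sum of its increments up to [minr a b]: a point of
[S] is below [minr a b] iff it is below both [a] and [b]. *)
Lemma expR_dist_kernel (S : {fset R}) :
  exists2 g : S -> R, (forall t, 0 < g t) &
    forall a b, a \in S -> b \in S -> expR (- `|a - b|) =
      \sum_t g t * ((expR (- a) * (val t <= a)%R%:R) *
                    (expR (- b) * (val t <= b)%R%:R)).
Proof.
pose s := sort <=%R S.
have [g g0 gE] : exists2 g : R -> R, (forall t, t \in s -> 0 < g t) &
    forall a, a \in s -> \sum_(t <- s) g t * (t <= a)%R%:R = expR (2 * a) - 0.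
  apply: increments_of_sorted.
  - by move=> x y xy; rewrite ltr_expR; lra.
  - by rewrite sort_lt_sorted fset_uniq.
  - by move=> y _; exact: expR_gt0.
exists (fun t => g (val t)) => [t|a b].
  by apply: g0; rewrite mem_sort; exact: fsvalP.
wlog ab : a b / a <= b.
  move=> H aS bS; have [ab|/ltW ba] := leP a b; first exact: H.
  by rewrite distrC (H b a)//; apply: eq_bigr => t _; ring.
move=> aS bS; transitivity (expR (- a) * expR (- b) * expR (2 * a)).
  by rewrite -!expRD ler0_norm ?subr_le0//; congr expR; ring.
rewrite -[expR (2 * a)]subr0 -gE ?mem_sort// (perm_big S) ?perm_sort//=.
rewrite big_seq_fsetE /= mulr_sumr; apply: eq_bigr => t _.
have [ta|_] := boolP (val t <= a); last by rewrite !(mulr0, mul0r).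
by rewrite (le_trans ta ab) !mulr1; ring.
Qed.

Context {N : nat}.
Implicit Types (x y : 'rV[R]_N).

Definition simK x y : R := expR (- d1 x y).

Lemma simK_xx x : simK x x = 1.
Proof. by rewrite /simK d1xx oppr0 expR0. Qed.

Lemma simKC x y : simK x y = simK y x.
Proof. by rewrite /simK d1_sym. Qed.

Lemma simK_prod x y : simK x y = \prod_k expR (- `|x 0 k - y 0 k|).
Proof. by rewrite /simK /d1 -sumrN expR_sum. Qed.

(** Expanding the product over the coordinates of the decompositions
[expR_dist_kernel] gives one feature [u j] for each choice of a threshold on
every axis.  The thresholds given by the coordinates of [x i] yield a feature
that detects the points above [x i]; this triangularity is what makes the kernel
strictly positive definite. *)
Lemma simK_features (I : finType) (x : I -> 'rV[R]_N) :
  exists (J : finType) (g : J -> R) (u : J -> I -> R),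
    [/\ forall j, 0 < g j,
        forall i i', simK (x i) (x i') = \sum_j g j * (u j i * u j i')
      & forall i, exists j, forall i',
         (u j i' != 0) = [forall k, x i 0 k <= x i' 0 k]].
Proof.
pose S : {fset R} := [fset x ik.1 0 ik.2 | ik : I * 'I_N]%fset.
have xS i k : x i 0 k \in S.
  by apply/imfsetP; exists (i, k).
have [g g0 gE] := expR_dist_kernel S.
exists {ffun 'I_N -> S}, (fun f : {ffun 'I_N -> S} => \prod_k g (f k)),
  (fun (f : {ffun 'I_N -> S}) i =>
     \prod_k (expR (- x i 0 k) * (val (f k) <= x i 0 k)%R%:R)).
split=> [f|i i'|i].
- by apply: prodr_gt0.
- rewrite simK_prod; under eq_bigr do rewrite gE//.
  rewrite bigA_distr_bigA; apply: eq_bigr => f _.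
  by rewrite -!big_split.
- exists [ffun k => [` xS i k]%fset] => i'.
  apply/prodf_neq0/forallP => h k.
    have /= := h k isT; rewrite ffunE /=.
    by case: (_ <= _) => //; rewrite mulr0 eqxx.
  by move=> _; rewrite ffunE /= h mulr1 gt_eqF// expR_gt0.
Qed.

Lemma quad_form_features (I J : finType) (c : I -> R) (g : J -> R)
    (u : J -> I -> R) :
  \sum_i \sum_i' c i * c i' * (\sum_j g j * (u j i * u j i')) =
  \sum_j g j * (\sum_i c i * u j i) ^+ 2.
Proof.
under eq_bigr do under eq_bigr do rewrite mulr_sumr.
under eq_bigr do rewrite exchange_big /=.
rewrite exchange_big /=; apply: eq_bigr => j _.
rewrite expr2 big_distrlr /= mulr_sumr; apply: eq_bigr => i _.
by rewrite mulr_sumr; apply: eq_bigr => i' _; ring.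
Qed.

Lemma simK_psd (I : finType) (c : I -> R) (x : I -> 'rV[R]_N) :
  0 <= \sum_i \sum_i' c i * c i' * simK (x i) (x i').
Proof.
have [J [g [u [g0 xE _]]]] := simK_features x.
under eq_bigr do under eq_bigr do rewrite xE.
rewrite quad_form_features; apply: sumr_ge0 => j _.
by rewrite mulr_ge0 ?sqr_ge0// ltW.
Qed.

(** The quadratic form of [c] vanishes, hence so does every
[\sum_i c i * u j i]. If some [c i] were nonzero, choose such an [i] with
maximal coordinate sum: the feature detecting the points above [x i] would then
meet the support of [c] in [i] only. *)
Lemma simK_injective (I : finType) (c : I -> R) (x : I -> 'rV[R]_N) :
  injective x -> (forall i, \sum_i' c i' * simK (x i) (x i') = 0) ->
  forall i, c i = 0.
Proof.
move=> xinj c0; have [J [g [u [g0 xE uE]]]] := simK_features x.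
have cu j : \sum_i c i * u j i = 0.
  have : \sum_j g j * (\sum_i c i * u j i) ^+ 2 = 0.
    rewrite -quad_form_features big1// => i _.
    rewrite -[RHS](mulr0 (c i)) -[in RHS](c0 i) mulr_sumr.
    by apply: eq_bigr => i' _; rewrite xE mulrA.
  move=> /eqP; rewrite psumr_eq0; last first.
    by move=> k _; rewrite mulr_ge0 ?sqr_ge0// ltW.
  move=> /allP/(_ j); rewrite mem_index_enum => /(_ isT).
  by rewrite /= mulf_eq0 gt_eqF//= sqrf_eq0 => /eqP.
move=> i0; apply/eqP/negPn/negP => ci0.
have [i /= ci imax] := @arg_maxP _ _ _ i0 (fun i => c i != 0)
  (fun i => \sum_k x i 0 k) ci0.
have [j uj] := uE i.
have := cu j; rewrite (bigD1 i)//= big1 ?addr0.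
  by apply/eqP; rewrite mulf_neq0// uj; apply/forallP.
move=> i' i'i; apply/eqP; rewrite mulf_eq0; apply/orP.
have [?|ci'] := eqVneq (c i') 0; [by left | right].
apply/negPn/negP; rewrite uj => /forallP xii'.
move/eqP: i'i; apply; apply: xinj; apply/rowP => k; apply/esym/eqP.
have /eqP : \sum_k (x i' 0 k - x i 0 k) = 0.
  apply/eqP; rewrite eq_le; apply/andP; split.
    by rewrite sumrB subr_le0 imax.
  by apply: sumr_ge0 => l _; rewrite subr_ge0.
rewrite psumr_eq0 => [|l _]; last by rewrite subr_ge0.
by move=> /allP/(_ k); rewrite mem_index_enum subr_eq0 eq_sym => /(_ isT).
Qed.

End PositiveDefinite.

(** * Magnitudes of finite sets as masses of measures *)

Section FiniteMagnitude.
Context {R : realType} {N : nat}.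
Implicit Types (G : {fset l1 R N}).

Lemma fmag_weights G :
  exists (n : nat) (p : 'I_n -> l1 R N) (w : 'I_n -> R),
    [/\ forall x, x \in G <-> exists i, x = p i,
        forall i, \sum_j w j * simK (p i) (p j) = 1 & fmag G = \sum_j w j].
Proof.
pose p i := tnth (in_tuple G) i.
have pinj : injective p.
  move=> i j; have [x0 _] : exists x0 : l1 R N, True by exists (p i).
  rewrite /p !(tnth_nth x0) /= => /eqP; rewrite nth_uniq ?fset_uniq// => /eqP.
  exact: val_inj.
have simU : sim_mx G \in unitmx.
  rewrite -row_free_unit -kermx_eq0; apply/eqP/row_matrixP => k.
  rewrite row0; suff kerG (v : 'rV_#|` G|) : v *m sim_mx G = 0 -> v = 0.
    by apply: kerG; rewrite -row_mul mulmx_ker row0.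
  move=> vG.
  apply/rowP => j; rewrite [RHS]mxE; move: j.
  apply: (@simK_injective R N _ (fun j => v 0 j) p pinj) => i.
  have /rowP/(_ i) := vG; rewrite !mxE => vGi; rewrite -[RHS]vGi.
  by apply: eq_bigr => i' _; rewrite mxE simKC.
exists #|` G|, p, (fun j => weighting G j 0); split=> [x|i|//].
  by split=> /(tnthP (in_tuple G)).
have /matrixP/(_ i 0) : sim_mx G *m weighting G = const_mx 1.
  by rewrite /weighting mulKVmx.
rewrite !mxE => wE; rewrite -[RHS]wE; apply: eq_bigr => j _.
by rewrite [in RHS]mxE mulrC.
Qed.

(** With [w] the weighting of [G], the energy of [c - w] is nonnegative; pairing
the potentials with the weights evaluates it to [\sum_i c i - fmag G]. *)
Lemma fmag_le_mass (I : finType) (c : I -> R) (x : I -> l1 R N) G :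
  (forall y, y \in G -> \sum_i c i * simK y (x i) = 1) ->
  (forall i', c i' != 0 -> \sum_i c i * simK (x i') (x i) = 1) ->
  fmag G <= \sum_i c i.
Proof.
move=> Gc xc; have [n [p [w [pG pw ->]]]] := fmag_weights G.
pose d (s : I + 'I_n) := match s with inl i => c i | inr j => - w j end.
pose z (s : I + 'I_n) := match s with inl i => x i | inr j => p j end.
have := simK_psd d z.
rewrite big_sumType /=.
have -> : \sum_i \sum_i' c i * d i' * simK (x i) (z i') =
    \sum_i c i - \sum_j w j.
  under eq_bigr => i _.
    rewrite big_sumType /=.
    under eq_bigr do rewrite -mulrA.
    have -> : \sum_i' c i * (c i' * simK (x i) (x i')) = c i.
      rewrite -mulr_sumr; have [->|/xc->] := eqVneq (c i) 0.
        by rewrite mul0r.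
      by rewrite mulr1.
    over.
  rewrite big_split /=; congr (_ + _).
  rewrite exchange_big /= -sumrN; apply: eq_bigr => j _.
  rewrite -[RHS]mulr1 -(Gc (p j)); last by apply/pG; exists j.
  by rewrite mulr_sumr; apply: eq_bigr => i _; rewrite simKC; ring.
have -> : \sum_j \sum_i' - w j * d i' * simK (p j) (z i') = 0.
  apply: big1 => j _; rewrite big_sumType /=.
  under eq_bigr do rewrite -mulrA.
  rewrite -mulr_sumr Gc; last by apply/pG; exists j.
  under [X in _ + X]eq_bigr do rewrite mulrNN -mulrA.
  by rewrite -mulr_sumr pw; ring.
by rewrite addr0 subr_ge0.
Qed.

(** Both sides are the mutual energy of [c] and the weighting of [G]. *)
Lemma fmag_mass (I : finType) (c : I -> R) (x : I -> l1 R N) G :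
  (forall y, y \in G -> \sum_i c i * simK y (x i) = 1) ->
  (forall i, x i \in G) ->
  fmag G = \sum_i c i.
Proof.
move=> Gc xG; have [n [p [w [pG pw ->]]]] := fmag_weights G.
transitivity (\sum_j \sum_i w j * (c i * simK (p j) (x i))).
  by apply: eq_bigr => j _; rewrite -mulr_sumr Gc ?mulr1//; apply/pG; exists j.
rewrite exchange_big /=; apply: eq_bigr => i _.
have /pG[j xj] := xG i.
rewrite -[RHS]mulr1 -(pw j) mulr_sumr xj; apply: eq_bigr => j' _.
by rewrite simKC; ring.
Qed.

Lemma mag_le (K : set (l1 R N)) (M : R) :
  (forall G, [set` G] `<=` K -> fmag G <= M) -> mag K <= M.
Proof.
move=> GM; apply: ge_sup; last by move=> _ [G GK <-]; exact: GM.
by exists (fmag (fset0 : {fset l1 R N})), fset0 => // x /=; rewrite inE.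
Qed.

Lemma fmag_le_mag (K : set (l1 R N)) (M : R) G :
  (forall G, [set` G] `<=` K -> fmag G <= M) ->
  [set` G] `<=` K -> fmag G <= mag K.
Proof.
move=> GM GK; apply: ub_le_sup; last by exists G.
by exists M => _ [G' GK' <-]; exact: GM.
Qed.

Lemma mag_finite G : mag [set` G] = fmag G.
Proof.
have GM G' : [set` G'] `<=` [set` G] -> fmag G' <= fmag G.
  move=> G'G; have [n [p [w [pG pw ->]]]] := fmag_weights G.
  apply: (fmag_le_mass (x := p)) => [y /G'G/pG[i ->]|] //.
by apply/eqP; rewrite eq_le mag_le//= (fmag_le_mag GM).
Qed.

End FiniteMagnitude.

(** * Solutions of linear systems depending on a parameter *)

Section LinearSystem.
Context {R : realType} {T : Type} {F : set_system T} {FF : Filter F}.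

Lemma cvg_prod_big (I : Type) (r : seq I) (P : pred I) (f : I -> T -> R)
    (l : I -> R) :
  (forall i, P i -> f i t @[t --> F] --> l i) ->
  \prod_(i <- r | P i) f i t @[t --> F] --> \prod_(i <- r | P i) l i.
Proof. by apply: cvg_big; exact: mul_continuous. Qed.

Lemma cvg_sum_big (I : Type) (r : seq I) (P : pred I) (f : I -> T -> R)
    (l : I -> R) :
  (forall i, P i -> f i t @[t --> F] --> l i) ->
  \sum_(i <- r | P i) f i t @[t --> F] --> \sum_(i <- r | P i) l i.
Proof. by apply: cvg_big; exact: add_continuous. Qed.

Lemma cvg_det n (A : T -> 'M[R]_n) (A0 : 'M[R]_n) :
  (forall i j, A t i j @[t --> F] --> A0 i j) ->
  \det (A t) @[t --> F] --> \det A0.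
Proof.
move=> AA0; apply: cvg_sum_big => s _; apply: cvgM; first exact: cvg_cst.
exact: cvg_prod_big.
Qed.

Lemma cvg_invmx n (A : T -> 'M[R]_n) (A0 : 'M[R]_n) :
  A0 \in unitmx ->
  (forall i j, A t i j @[t --> F] --> A0 i j) ->
  (\forall t \near F, A t \in unitmx) /\
  forall i j, invmx (A t) i j @[t --> F] --> invmx A0 i j.
Proof.
move=> A0U AA0; have detA := cvg_det AA0.
have det0 : \det A0 != 0 by move: A0U; rewrite unitmxE unitfE.
have AU : \forall t \near F, A t \in unitmx.
  apply: filterS (cvgr_neq0 _ detA det0) => t.
  by rewrite unitmxE unitfE.
split=> // i j.
have invE B : B \in unitmx ->
    invmx B i j = (\det B)^-1 * ((-1) ^+ (j + i) * \det (row' j (col' i B))).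
  by move=> BU; rewrite /invmx BU !mxE.
pose f t := (\det (A t))^-1 * ((-1) ^+ (j + i) * \det (row' j (col' i (A t)))).
have cvgf : f t @[t --> F] --> invmx A0 i j.
  rewrite invE//; apply: cvgM; first exact: (cvgV det0 detA).
  apply: cvgM; first exact: cvg_cst.
  apply: (@cvg_det _ (fun t => row' j (col' i (A t)))) => k l.
  by rewrite !mxE; under eq_cvg do rewrite !mxE; exact: AA0.
apply: cvg_trans cvgf; apply: near_eq_cvg; apply: filterS AU => t AtU.
by rewrite /f invE.
Qed.

(** Stated for systems indexed by an arbitrary finite type, because the system
solved below is indexed by pairs of points. *)
Lemma cvg_linear_system (I : finType) (A : T -> I -> I -> R) (A0 : I -> I -> R)
    (v : I -> R) :
  (forall b, (forall i, \sum_j A0 i j * b j = 0) -> forall j, b j = 0) ->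
  (forall i j, A t i j @[t --> F] --> A0 i j) ->
  exists (b : T -> I -> R) (b0 : I -> R),
    [/\ forall i, \sum_j A0 i j * b0 j = v i,
        forall j, b t j @[t --> F] --> b0 j
      & \forall t \near F, forall i, \sum_j A t i j * b t j = v i].
Proof.
move=> A0inj AA0.
pose M (B : I -> I -> R) : 'M[R]_#|I| :=
  \matrix_(i, j) B (enum_val i) (enum_val j).
pose V : 'cV[R]_#|I| := \col_i v (enum_val i).
pose sol B (i : I) := (invmx (M B) *m V) (enum_rank i) 0.
have solE B : M B \in unitmx -> forall i, \sum_j B i j * sol B j = v i.
  move=> BU i; have /matrixP/(_ (enum_rank i) 0) := mulKVmx BU V.
  rewrite [X in X = _]mxE [X in _ = X]mxE enum_rankK => <-.
  rewrite (reindex_onto enum_val enum_rank) /=; last first.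
    by move=> j _; rewrite enum_rankK.
  apply: eq_big => [j|j _]; first by rewrite enum_valK eqxx.
  by rewrite /sol enum_valK !mxE enum_rankK.
have MA0U : M A0 \in unitmx.
  rewrite -unitmx_tr -row_free_unit -kermx_eq0; apply/eqP/row_matrixP => k.
  rewrite row0; suff kerM (b : 'rV_#|I|) : b *m (M A0)^T = 0 -> b = 0.
    by apply: kerM; rewrite -row_mul mulmx_ker row0.
  move=> bM.
  apply/rowP => j; rewrite [RHS]mxE -(enum_valK j); move: (enum_val j).
  apply: (A0inj (fun j => b 0 (enum_rank j))) => i.
  have /rowP/(_ (enum_rank i)) := bM.
  rewrite [X in X = _]mxE [X in _ = X]mxE => bMi; rewrite -[RHS]bMi.
  rewrite (reindex_onto enum_val enum_rank) /=; last first.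
    by move=> l _; rewrite enum_rankK.
  apply: eq_big => [l|l _]; first by rewrite enum_valK eqxx.
  by rewrite !mxE enum_rankK enum_valK mulrC.
have [|MAU MAV] := @cvg_invmx _ (fun t => M (A t)) (M A0) MA0U.
  by move=> i j; rewrite mxE; under eq_cvg do rewrite mxE; exact: AA0.
exists (fun t => sol (A t)), (sol A0); split.
- exact: solE.
- move=> j; rewrite /sol mxE; under eq_cvg do rewrite mxE.
  apply: cvg_sum_big => i _; apply: cvgM; [exact: MAV | exact: cvg_cst].
- by apply: filterS MAU => t /solE.
Qed.

End LinearSystem.

(** * Measures on an interval of the line *)

Section Interval.
Context {R : realType}.
Implicit Types (a b t : R) (s : seq R) (S : {fset R}).

(** A new leftmost point [x] is added to [y :: s] by putting mass [a] at [x] and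
adding [b] to the mass at [y].  To the right of [y] these cancel, as
[a * expR (x - y) + b = 0]; at [x] they complete the old potential
[expR (x - y)] to [1].  The mass grows by [(1 - e) / (1 + e)] with
[e = expR (x - y)], which lies between [0] and [y - x]. *)
Lemma sorted_weighting (x : R) s : sorted <%R (x :: s) ->
  exists w : R -> R,
    [/\ forall y, y \notin x :: s -> w y = 0,
        forall z, z \in x :: s ->
          \sum_(y <- x :: s) w y * expR (- `|z - y|) = 1,
        1 <= \sum_(y <- x :: s) w y
      & \sum_(y <- x :: s) w y <= 1 + (last x s - x)].
Proof.
elim: s x => [|y s IH] x /=.
  move=> _; exists (fun y => (y == x)%:R); split=> [y|z| |].
  - by rewrite inE => /negbTE->.
  - rewrite inE => /eqP->.
    by rewrite big_seq1 subrr normr0 oppr0 expR0 eqxx mulr1.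
  - by rewrite big_seq1 eqxx.
  - by rewrite big_seq1 eqxx subrr addr0.
case/andP=> xy ys; have [w [w0 w1 wge1 wle]] := IH y ys.
have xlt z : z \in y :: s -> x < z.
  rewrite inE => /predU1P[->//|zs]; apply: lt_trans xy _.
  by move: z zs; apply/allP; apply: order_path_min ys; exact: lt_trans.
have xNys : x \notin y :: s by apply/negP => /xlt; rewrite ltxx.
pose e := expR (x - y).
have e0 : 0 < e by exact: expR_gt0.
have e1 : e < 1 by rewrite /e -expR0 ltr_expR subr_lt0.
pose a := (1 + e)^-1; pose b := - e / (1 + e).
pose w' z := w z + a * (z == x)%:R + b * (z == y)%:R.
have sumE (f : R -> R) : \sum_(z <- x :: y :: s) w' z * f z =
    \sum_(z <- y :: s) w z * f z + a * f x + b * f y.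
  have pick z (t : seq R) : z \in t -> uniq t ->
      \sum_(u <- t) (u == z)%:R * f u = f z.
    move=> zt tu; rewrite (bigD1_seq z)//= eqxx mul1r big1 ?addr0// => u.
    by move=> /negbTE->; rewrite mul0r.
  have xysu : uniq (x :: y :: s).
    by apply: (sorted_uniq lt_trans ltxx); rewrite /= xy.
  under eq_bigr do rewrite /w' !mulrDl -!mulrA.
  rewrite !big_split /= -!mulr_sumr !pick ?inE ?eqxx ?orbT//.
  by rewrite big_cons w0// mul0r add0r /b mulrA.
have sum1E : \sum_(z <- x :: y :: s) w' z = \sum_(z <- y :: s) w z + a + b.
  under eq_bigr do rewrite -[w' _]mulr1.
  rewrite (sumE (fun=> 1)) !mulr1; congr (_ + _ + _).
  by apply: eq_bigr => z _; rewrite mulr1.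
exists w'; split=> [z|z| |].
- rewrite !inE !negb_or => /and3P[zx zy zs].
  rewrite /w' w0; last by rewrite inE negb_or zy.
  by rewrite (negbTE zx) (negbTE zy) !mulr0 !addr0.
- rewrite sumE /= inE => /predU1P[->{z}|zys].
    have -> : \sum_(z <- y :: s) w z * expR (- `|x - z|) = e.
      rewrite -[RHS]mulr1 -(w1 y) ?mem_head// mulr_sumr.
      apply: eq_big_seq => z zys; rewrite mulrCA -expRD; congr (_ * expR _).
      have yz : y <= z.
        move: zys; rewrite inE => /predU1P[->//|zs]; apply: ltW.
        by move: z zs; apply/allP; apply: order_path_min ys; exact: lt_trans.
      by rewrite !ler0_norm ?subr_le0 ?(ltW (xlt _ zys))//; ring.
    rewrite subrr normr0 oppr0 expR0 mulr1 ler0_norm ?subr_le0 ?ltW// opprK -/e.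
    by rewrite /a /b; field; lra.
  rewrite w1//.
  have yz : y <= z.
    move: zys; rewrite inE => /predU1P[->//|zs]; apply: ltW.
    by move: z zs; apply/allP; apply: order_path_min ys; exact: lt_trans.
  rewrite !ger0_norm ?subr_ge0 ?(ltW (xlt _ zys))//.
  have -> : - (z - x) = (x - y) + - (z - y) by ring.
  by rewrite expRD -/e /a /b; field; lra.
- rewrite sum1E.
  suff : 0 <= a + b by lra.
  have -> : a + b = (1 - e) / (1 + e) by rewrite /a /b; field; lra.
  by apply: divr_ge0; lra.
- rewrite sum1E.
  suff : a + b <= y - x by lra.
  have -> : a + b = (1 - e) / (1 + e) by rewrite /a /b; field; lra.
  have := expR_ge1Dx (x - y); rewrite -/e => ege.
  rewrite ler_pdivrMr; last lra.
  apply: le_trans (_ : y - x <= _); first lra.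
  by rewrite ler_peMr; lra.
Qed.

Lemma interval_weighting S a b : a <= b -> a \in S -> b \in S ->
  exists w : S -> R,
    [/\ forall y, w y != 0 -> a <= val y <= b,
        forall z, z \in S -> a <= z <= b ->
          \sum_y w y * expR (- `|z - val y|) = 1
      & 1 <= \sum_y w y <= 1 + (b - a)].
Proof.
move=> ab aS bS.
pose s := sort <=%R [seq y <- S | a <= y <= b].
have memE y : y \in s = (y \in S) && (a <= y <= b).
  by rewrite mem_sort mem_filter andbC.
have ss : sorted <%R s by rewrite sort_lt_sorted filter_uniq// fset_uniq.
have [x [s' sE]] : exists x s', s = x :: s'.
  case: s memE {ss} => [/(_ a)|x s' _]; last by exists x, s'.
  by rewrite aS lexx ab.
have [w [w0 w1 wge wle]] := sorted_weighting (etrans (congr1 _ (esym sE)) ss).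
rewrite -sE in w0 w1 wge wle.
have xs : x \in s by rewrite sE mem_head.
have ls : last x s' \in s by rewrite sE mem_last.
have sumE (f : R -> R) :
    \sum_(y : S) w (val y) * f (val y) = \sum_(y <- s) w y * f y.
  rewrite -(big_seq_fsetE _ S xpredT (fun y => w y * f y)) /=.
  rewrite (bigID (fun y => a <= y <= b)) /= [X in _ + X]big1_seq ?addr0.
    by rewrite -big_filter; apply: perm_big; rewrite perm_sym perm_sort.
  move=> y /andP[yab yS]; rewrite w0 ?mul0r// memE negb_and.
  by rewrite yab orbT.
exists (fun y => w (val y)); split=> [y|z zS zab|].
- move=> wy; have : val y \in s by apply: contraNT wy => /w0->.
  by rewrite memE => /andP[].
- by rewrite (sumE (fun y => expR (- `|z - y|))) w1// memE zS.
- have -> : \sum_(y : S) w (val y) = \sum_(y <- s) w y.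
    have /= := sumE (fun=> 1); under eq_bigr do rewrite mulr1.
    by under [in RHS]eq_bigr do rewrite mulr1.
  rewrite wge /=; apply: le_trans wle _.
  move: xs ls; rewrite !memE => /andP[_ /andP[ax xb]] /andP[_ /andP[al lb]].
  lra.
Qed.

Lemma sgr_cases (u : R) : u != 0 -> Num.sg u = 1 \/ Num.sg u = -1.
Proof.
rewrite neq_lt => /orP[u0|u0].
  by right; exact: ltr0_sg.
by left; exact: gtr0_sg.
Qed.

(** For [u = 0] the measure is the weighting of the points of [S] in the
interval; for [u != 0] it is a point mass at the end of the interval on the side
of [u].  Outside the interval, a potential decays exponentially from its value
at the nearest end, which accounts for the third clause. *)
Lemma interval_measure S a (r u : R) : 0 < r -> a - r \in S -> a + r \in S ->
  exists w : S -> R,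
    [/\ forall y, w y != 0 -> `|val y - a| <= r,
        forall t, t \in S -> `|t - a| <= r ->
          \sum_y w y * expR (- `|t - val y|) = expR (Num.sg u * (t - a)),
        forall t, r <= `|t - a| ->
          \sum_y w y * expR (- `|t - val y|) =
          expR (- `|t - a| + r + r * (Num.sg u * Num.sg (t - a))),
        u = 0 -> 1 <= \sum_y w y <= 1 + 2 * r
      & u != 0 -> \sum_y w y = expR r].
Proof.
move=> r0 arS aS.
suff [w [w_supp w_in w_mass0 w_mass1]] : exists w : S -> R,
    [/\ forall y, w y != 0 -> `|val y - a| <= r,
        forall t, t \in S -> `|t - a| <= r ->
          \sum_y w y * expR (- `|t - val y|) = expR (Num.sg u * (t - a)),
        u = 0 -> 1 <= \sum_y w y <= 1 + 2 * r
      & u != 0 -> \sum_y w y = expR r].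
  exists w; split=> // t rt.
  have ta0 : t - a != 0 by rewrite -normr_gt0; lra.
  pose e := Num.sg (t - a); pose z := a + r * e.
  have eE : e = 1 \/ e = -1.
    exact: sgr_cases.
  have zS : z \in S by rewrite /z; case: eE => ->; rewrite ?mulrN mulr1.
  have za : `|z - a| <= r.
    rewrite /z addrAC subrr add0r normrM (gtr0_norm r0).
    by case: eE => ->; rewrite ?normrN normr1 mulr1.
  have -> : - `|t - a| + r + r * (Num.sg u * e) =
      (- `|t - a| + r) + Num.sg u * (z - a) by rewrite /z; ring.
  rewrite expRD -(w_in z zS za) mulr_sumr; apply: eq_bigr => y _.
  have [->|wy] := eqVneq (w y) 0; first by rewrite !mul0r mulr0.
  have := w_supp y wy; rewrite ler_norml => /andP[ya1 ya2].
  rewrite mulrCA -expRD; congr (_ * expR _).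
  have [ta|ta] := ltP a t.
    rewrite /z /e gtr0_sg ?subr_gt0// mulr1.
    move: rt; rewrite gtr0_norm ?subr_gt0// => rt.
    by rewrite !ger0_norm; lra.
  rewrite /z /e ltr0_sg; last by rewrite lt_neqAle ta0 subr_le0.
  move: rt; rewrite ler0_norm ?subr_le0// => rt.
  by rewrite !ler0_norm; lra.
have [->|u0] := eqVneq u 0.
  have [|w [wab w1 w2]] := @interval_weighting S (a - r) (a + r) _ arS aS.
    lra.
  exists w; split=> //; rewrite ?sgr0.
  - by move=> y /wab; rewrite ler_norml => /andP[? ?]; apply/andP; split; lra.
  - move=> t tS; rewrite mul0r expR0 ler_norml => /andP[? ?]; apply: w1 => //.
    by apply/andP; split; lra.
  - by move=> _; have -> : 2 * r = (a + r) - (a - r) by ring.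
pose e := Num.sg u.
have eE : e = 1 \/ e = -1.
  exact: sgr_cases.
have zS : a + r * e \in S by case: eE => ->; rewrite ?mulrN mulr1.
have sumE (f : R -> R) :
    \sum_(y : S) (expR r * (val y == a + r * e)%:R) * f (val y) =
    expR r * f (a + r * e).
  rewrite (bigD1 [` zS]%fset)//= eqxx mulr1 big1 ?addr0// => y yz.
  suff /negbTE-> : val y != a + r * e by rewrite mulr0 mul0r.
  by apply: contraNneq yz => yz; apply/eqP/val_inj.
exists (fun y => expR r * (val y == a + r * e)%:R); split=> [y|t _|/eqP|_].
- have [->|] := eqVneq (val y) (a + r * e); last by rewrite mulr0 eqxx.
  move=> _; rewrite addrAC subrr add0r normrM (gtr0_norm r0).
  by case: eE => ->; rewrite ?normrN normr1 mulr1.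
- rewrite ler_norml => /andP[ta1 ta2].
  rewrite (sumE (fun y => expR (- `|t - y|))) -expRD -/e; congr expR.
  case: eE => ->.
    by rewrite ler0_norm; lra.
  by rewrite ger0_norm; lra.
- by rewrite (negbTE u0).
- have /= := sumE (fun=> 1); under eq_bigr do rewrite mulr1.
  by rewrite mulr1.
Qed.

End Interval.

(** * The upper bound on a union of small cubes *)

Section Cubes.
Context {R : realType} {N : nat} {I : finType} (p : I -> 'rV[R]_N).

(** The potential at [p t] of the product measure on the cube around [p q] whose
potential on that cube is the product over [k] of the exponentials of
[sg (p q'_k - p q_k) * (x_k - p q_k)], when the projections of [p t] to the axes
lie outside those of the cube; for [q' = q] that function is the constant [1].
*)
Definition interaction (r : R) (q q' t : I) : R :=
  \prod_k expR (- `|p t 0 k - p q 0 k| + r +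
     r * (Num.sg (p q' 0 k - p q 0 k) * Num.sg (p t 0 k - p q 0 k))).

(** The measure with potential [1] is the combination, with coefficients
[b q q'], of the product measures that [interaction] describes.  The third
hypothesis says that on the cube around [p t] the coefficient of the exponential
directed towards [p q], collected from that cube itself and from the cube around
[p q], is [0], and that the constant function has coefficient [1]. *)
Lemma fmag_cubes_le (r : R) (b : I -> I -> R) (G : {fset l1 R N}) :
  0 < r ->
  (forall q q' k, q != q' -> 2 * r < `|p q 0 k - p q' 0 k|) ->
  (forall t q, b t q + (t != q)%:R * \sum_q' b q q' * interaction r q q' t =
     (t == q)%:R) ->
  [set` G] `<=` \bigcup_q cube (p q) r ->
  fmag G <= \sum_q \sum_q' b q q' *
     (if q == q' then (1 + 2 * r) ^+ N else expR r ^+ N).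
Proof.
move=> r0 sep bsys GC.
(* A grid of coordinates that contains [G] and the corners of the cubes. *)
pose S : {fset R} := ([fset (y : 'rV[R]_N) 0 k | y in G, k in 'I_N] `|`
  ([fset (p qk.1 0 qk.2 - r)%R | qk : I * 'I_N] `|`
   [fset (p qk.1 0 qk.2 + r)%R | qk : I * 'I_N]))%fset.
have GS (y : 'rV[R]_N) k : y \in G -> y 0 k \in S.
  move=> yG; rewrite !in_fsetU; apply/orP; left.
  by apply/imfset2P; exists y => //; exists k.
have pBrS q k : p q 0 k - r \in S.
  rewrite !in_fsetU; apply/orP; right; apply/orP; left.
  by apply/imfsetP; exists (q, k).
have pDrS q k : p q 0 k + r \in S.
  rewrite !in_fsetU; apply/orP; right; apply/orP; right.
  by apply/imfsetP; exists (q, k).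
have [w wP] := choice (fun x : I * I * 'I_N =>
  @interval_measure R S (p x.1.1 0 x.2) r (p x.1.2 0 x.2 - p x.1.1 0 x.2) r0
    (pBrS x.1.1 x.2) (pDrS x.1.1 x.2)).
pose J := (I * I * {ffun 'I_N -> S})%type.
pose c (j : J) : R := b j.1.1 j.1.2 * \prod_k w (j.1, k) (j.2 k).
pose z (j : J) : l1 R N := \row_k val (j.2 k).
have tensorE (g : 'I_N -> S -> R) : \sum_j c j * \prod_k g k (j.2 k) =
    \sum_q \sum_q' b q q' * \prod_k \sum_y w (q, q', k) y * g k y.
  rewrite pair_bigA /= -(pair_bigA _ (fun qq (f : {ffun 'I_N -> S}) =>
    c (qq, f) * \prod_k g k (f k))) /=.
  apply: eq_bigr => -[q q'] _ /=; rewrite bigA_distr_bigA mulr_sumr.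
  by apply: eq_bigr => f _; rewrite /c /= big_split mulrA.
have potE (y : 'rV[R]_N) q0 : (forall k, y 0 k \in S) ->
    (forall k, `|y 0 k - p q0 0 k| <= r) -> \sum_j c j * simK y (z j) = 1.
  move=> yS yq0.
  under eq_bigr => j _.
    rewrite simK_prod; under eq_bigr do rewrite mxE.
    over.
  rewrite (tensorE (fun k t => expR (- `|y 0 k - val t|))).
  pose g q := \prod_k expR (Num.sg (p q 0 k - p q0 0 k) * (y 0 k - p q0 0 k)).
  have gq0 : g q0 = 1.
    by rewrite /g big1// => k _; rewrite subrr sgr0 mul0r expR0.
  have self q' :
      \prod_k \sum_t w (q0, q', k) t * expR (- `|y 0 k - val t|) = g q'.
    apply: eq_bigr => k _; have [_ /= -> //] := wP (q0, q', k).
  have other q q' : q0 != q ->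
      \prod_k \sum_t w (q, q', k) t * expR (- `|y 0 k - val t|) =
      g q * interaction r q q' q0.
    move=> q0q; rewrite -big_split /=; apply: eq_bigr => k _.
    have := sep q0 q k q0q; have := yq0 k.
    rewrite ler_norml => /andP[y1 y2] pq.
    have [_ _ /= outside _ _] := wP (q, q', k).
    have [lt|gt|eq] := ltgtP (p q 0 k) (p q0 0 k).
    - move: pq; rewrite gtr0_norm ?subr_gt0// => pq.
      rewrite outside ?ger0_norm; try lra.
      rewrite -expRD; congr expR.
      rewrite (ltr0_sg (x := p q 0 k - _)); last lra.
      rewrite (gtr0_sg (x := y 0 k - _)); last lra.
      by rewrite (gtr0_sg (x := p q0 0 k - _)); [ring | lra].
    - move: pq; rewrite ltr0_norm ?subr_lt0// => pq.
      rewrite outside ?ler0_norm; try lra.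
      rewrite -expRD; congr expR.
      rewrite (gtr0_sg (x := p q 0 k - _)); last lra.
      rewrite (ltr0_sg (x := y 0 k - _)); last lra.
      by rewrite (ltr0_sg (x := p q0 0 k - _)); [ring | lra].
    - by move: pq; rewrite eq subrr normr0; lra.
  (* By [self] and [other], every potential is on this cube a multiple of some
     [g q]; the terms are collected by [q]. *)
  transitivity (\sum_q g q * (b q0 q + (q0 != q)%:R *
      \sum_q' b q q' * interaction r q q' q0)).
    under [RHS]eq_bigr do rewrite mulrDr.
    rewrite big_split /= (bigD1 q0)//=; congr (_ + _).
      by apply: eq_bigr => q' _; rewrite self mulrC.
    rewrite [RHS](bigD1 q0)//= eqxx mul0r mulr0 add0r; apply: eq_bigr => q qq0.
    rewrite eq_sym qq0 mul1r mulr_sumr; apply: eq_bigr => q' _.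
    by rewrite other 1?eq_sym//; ring.
  under eq_bigr do rewrite bsys.
  rewrite (bigD1 q0)//= eqxx gq0 mulr1 big1 ?addr0// => q qq0.
  by rewrite eq_sym (negbTE qq0) mulr0.
have /le_trans : fmag G <= \sum_j c j.
  apply: (fmag_le_mass (x := z)) => [y yG|j cj].
    have [q _ yq] := GC y yG.
    apply: (potE y q) => k; first exact: GS.
    by have := yq k; rewrite ler_distl.
  apply: (potE (z j) j.1.1) => k; rewrite mxE; first exact: fsvalP.
  have [+ _ _ _ _] := wP (j.1, k); apply.
  by move: cj; rewrite mulf_eq0 negb_or => /andP[_ /prodf_neq0]; apply.
apply.
have /= := tensorE (fun _ _ => 1); under eq_bigr do rewrite big1// mulr1.
move=> ->; apply: ler_sum => q _; apply: ler_sum => q' _.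
under eq_bigr do under eq_bigr do rewrite mulr1.
have [<-|qq'] := eqVneq q q'.
  have := bsys q q; rewrite eqxx mul0r addr0 => ->; rewrite !mul1r.
  rewrite -[X in _ ^+ X]card_ord -prodr_const; apply: ler_prod => k _.
  have [_ _ _ /(_ (subrr _))/andP[m1 m2] _] := wP (q, q, k).
  by rewrite m2 andbT; exact: le_trans m1.
rewrite -[X in _ ^+ X]card_ord -prodr_const le_eqVlt.
apply/orP; left; apply/eqP; congr (_ * _); apply: eq_bigr => k _.
have [_ _ _ _ /= -> //] := wP (q, q', k).
rewrite -normr_gt0; have := sep q' q k; rewrite eq_sym => /(_ qq'); lra.
Qed.

End Cubes.

(** * The limit of small perturbations *)

Section Limits.
Context {R : realType} {N : nat}.

Section Configuration.
Context {I : finType} (p : I -> 'rV[R]_N) (p_inj : injective p).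

Let G0 : {fset l1 R N} := [fset p q | q : I]%fset.

Lemma fmag_image (B : I -> R) :
  (forall t, \sum_q B q * simK (p t) (p q) = 1) -> fmag G0 = \sum_q B q.
Proof.
move=> B1; apply: (fmag_mass (x := p)) => [y /imfsetP[t _ ->]|q] //.
by apply/imfsetP; exists q.
Qed.

Lemma cvg_interaction (q q' t : I) :
  interaction p r q q' t @[r --> (0 : R)^'+] --> simK (p t) (p q).
Proof.
rewrite simK_prod; apply: cvg_prod_big => k _.
set c := - _; set d := _ * Num.sg _.
apply: continuous_cvg; first exact: continuous_expR.
have -> : c = c + 0 + 0 * d by rewrite mul0r !addr0.
apply: cvg_at_right_filter; apply: cvgD.
  by apply: cvgD; [rewrite mul0r !addr0; exact: cvg_cst | exact: cvg_id].
by apply: cvgM; [exact: cvg_id | exact: cvg_cst].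
Qed.

(** Writes the equations for [b] as one linear system indexed by pairs, as
needed for [cvg_linear_system]. *)
Lemma system_sum (C b : I -> I -> R) (t q : I) :
  \sum_x (((t, q) == x)%:R + (t != q)%:R * (q == x.1)%:R * C x.1 x.2) *
     b x.1 x.2 =
  b t q + (t != q)%:R * \sum_q' b q q' * C q q'.
Proof.
under eq_bigr do rewrite mulrDl; rewrite big_split /=; congr (_ + _).
  rewrite (bigD1 (t, q))//= eqxx mul1r big1 ?addr0// => x xtq.
  by rewrite eq_sym (negbTE xtq) mul0r.
rewrite -(pair_bigA _ (fun a c =>
  (t != q)%:R * (q == a)%:R * C a c * b a c)) /=.
rewrite (bigD1 q)//= [X in _ + X]big1 ?addr0 => [|a aq].
  by rewrite mulr_sumr; apply: eq_bigr => q' _; rewrite eqxx mulr1; ring.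
by rewrite big1// => c _; rewrite [q == a]eq_sym (negbTE aq) mulr0 !mul0r.
Qed.

(** In the limit the influence of the cube around [p q] on another cube involves
only the row sum of [b] at [q].  Adding the equations with a given [t] thus
leaves a system for the row sums, whose matrix is that of the kernel at the
points [p q]. *)
Lemma limit_system (b : I -> I -> R) (v : I -> I -> R) :
  (forall t q,
     b t q + (t != q)%:R * \sum_q' b q q' * simK (p t) (p q) = v t q) ->
  forall t, \sum_q (\sum_q' b q q') * simK (p t) (p q) = \sum_q v t q.
Proof.
move=> bv t; under [RHS]eq_bigr do rewrite -bv.
rewrite big_split /= [LHS](bigD1 t)//= simK_xx mulr1; congr (_ + _).
rewrite [RHS](bigD1 t)//= eqxx mul0r add0r; apply: eq_bigr => q qt.
by rewrite eq_sym qt mul1r mulr_suml.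
Qed.

(** The limit system is injective: by [limit_system] and positive definiteness a
solution of the homogeneous system has zero row sums, and then the equations
give [b = 0].  The masses of the product measures tend to [1], so the total mass
tends to the sum of the row sums. *)
Lemma fmag_cubes_bound (s : R) : 0 < s ->
  (forall q q' k, q != q' -> s <= `|p q 0 k - p q' 0 k|) ->
  exists2 U : R -> R, U r @[r --> 0^'+] --> fmag G0 &
    \forall r \near 0^'+, forall G : {fset l1 R N},
      [set` G] `<=` \bigcup_q cube (p q) r -> fmag G <= U r.
Proof.
move=> s0 sep.
pose A r (x y : I * I) : R := (x == y)%:R +
  (x.1 != x.2)%:R * (x.2 == y.1)%:R * interaction p r y.1 y.2 x.1.
pose A0 (x y : I * I) : R := (x == y)%:R +
  (x.1 != x.2)%:R * (x.2 == y.1)%:R * simK (p x.1) (p y.1).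
have [|x y|b [b0 [b0E bb0 bE]]] :=
    @cvg_linear_system R R 0^'+ _ (I * I)%type A A0 (fun x => (x.1 == x.2)%:R).
- move=> b Ab; pose b' t q := b (t, q).
  have b'E t q : b' t q + (t != q)%:R * \sum_q' b' q q' * simK (p t) (p q) = 0.
    rewrite -(system_sum (fun a _ => simK (p t) (p a))) -[RHS](Ab (t, q)).
    by apply: eq_bigr => -[].
  have B0 q : \sum_q' b' q q' = 0.
    move: q.
    apply: (@simK_injective R N I (fun q => \sum_q' b' q q') p p_inj) => t.
    by rewrite (limit_system b'E) big1.
  move=> [t q]; have := b'E t q.
  by rewrite -mulr_suml B0 mul0r mulr0 addr0.
- rewrite /A /A0; apply: cvgD; first exact: cvg_cst.
  by apply: cvgM; [exact: cvg_cst | exact: cvg_interaction].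
pose U r := \sum_q \sum_q' b r (q, q') *
     (if q == q' then (1 + 2 * r) ^+ N else expR r ^+ N).
have b0E' t q : b0 (t, q) + (t != q)%:R * \sum_q' b0 (q, q') * simK (p t) (p q)
    = (t == q)%:R.
  rewrite -(system_sum (fun a _ => simK (p t) (p a)) (fun t q => b0 (t, q))).
  by rewrite -[RHS](b0E (t, q)); apply: eq_bigr => -[].
exists U.
  rewrite (@fmag_image (fun q => \sum_q' b0 (q, q'))); last first.
    move=> t; rewrite (limit_system b0E').
    rewrite (bigD1 t)//= eqxx big1 ?addr0// => q.
    by rewrite eq_sym => /negbTE->.
  apply: cvg_sum_big => q _; apply: cvg_sum_big => q' _.
  rewrite -[X in _ --> X]mulr1; apply: cvgM; first exact: bb0.
  apply: cvg_at_right_filter; case: eqP => _.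
    rewrite -[X in _ --> X](expr1n R N).
    apply: (@continuous_cvg _ _ _ _ _ _ (fun x : R => x ^+ N)).
      exact: exprn_continuous.
    rewrite -[X in _ --> X]addr0 -[X in _ + X](mulr0 2).
    apply: cvgD; first exact: cvg_cst.
    by apply: cvgM; [exact: cvg_cst | exact: cvg_id].
  rewrite -[X in _ --> X](expr1n R N).
  apply: (@continuous_cvg _ _ _ _ _ _ (fun x : R => x ^+ N)).
    exact: exprn_continuous.
  by rewrite -[X in _ --> X](expR0 R); exact: continuous_expR.
near=> r => G GC.
have r0 : 0 < r by near: r; exact: nbhs_right_gt.
have rs : r < s / 2 by near: r; apply: nbhs_right_lt; lra.
have Ar : forall i, \sum_j A r i j * b r j = (i.1 == i.2)%:R by near: r.
apply: (@fmag_cubes_le R N I p r (fun q q' => b r (q, q')) G) => //.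
  by move=> q q' k /(sep q q' k); lra.
move=> t q.
rewrite -(system_sum (fun a c => interaction p r a c t)
  (fun t q => b r (t, q))).
by rewrite -[RHS](Ar (t, q)); apply: eq_bigr => -[].
Unshelve. all: by end_near. Qed.

(** The weights of [p' t] solve a system whose matrix converges to the one for
[p]. The points [p' t q] may coincide: [fmag_mass] asks for a measure with
potential [1], however its points are indexed. *)
Lemma fmag_lower {T : Type} {Fl : set_system T} {FF : Filter Fl}
    (p' : T -> I -> 'rV[R]_N) :
  (forall q, d1 (p q) (p' t q) @[t --> Fl] --> (0 : R)) ->
  exists2 L : T -> R, L t @[t --> Fl] --> fmag G0 &
    \forall t \near Fl, exists2 G : {fset l1 R N},
      (forall y, y \in G -> exists q, y = p' t q) & fmag G = L t.
Proof.
move=> pp'.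
have d1_cvg i j : d1 (p' t i) (p' t j) @[t --> Fl] --> (d1 (p i) (p j) : R).
  have h : d1 (p i) (p' t i) + d1 (p j) (p' t j) @[t --> Fl] --> (0 : R).
    by rewrite -[X in _ --> X]addr0; apply: cvgD.
  apply/cvgrPdist_le => e e0; move/cvgrPdist_le : h => /(_ e e0).
  apply: filterS => t; rewrite sub0r normrN; apply: le_trans.
  apply: le_trans (ler_norm _); rewrite ler_norml.
  have := d1_triangle (p' t i) (p i) (p' t j).
  have := d1_triangle (p i) (p' t i) (p j).
  have := d1_triangle (p j) (p' t i) (p' t j).
  have := d1_triangle (p' t j) (p i) (p j).
  have := d1_triangle (p' t j) (p' t i) (p j).
  rewrite (d1_sym (p' t i) (p i)) (d1_sym (p' t j) (p j)).
  by move=> ? ? ? ? ?; apply/andP; split; lra.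
have [|i j|b [b0 [b0E bb0 bE]]] := @cvg_linear_system R T Fl FF I
    (fun t i j => simK (p' t i) (p' t j)) (fun i j => simK (p i) (p j))
    (fun=> 1).
- move=> b bE; apply: (@simK_injective R N I b p p_inj) => i.
  by rewrite -[RHS](bE i); apply: eq_bigr => j _; rewrite mulrC.
- apply: continuous_cvg; first exact: continuous_expR.
  by apply: cvgN; exact: d1_cvg.
exists (fun t => \sum_j b t j).
  rewrite (@fmag_image b0); last first.
    by move=> t; rewrite -[RHS](b0E t); apply: eq_bigr => q _; rewrite mulrC.
  by apply: cvg_sum_big => q _; exact: bb0.
apply: filterS bE => t bE.
exists [fset p' t q | q : I]%fset.
  by move=> y /imfsetP[q _ ->]; exists q.
apply: (fmag_mass (x := p' t)) => [y /imfsetP[q _ ->]|q].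
  by rewrite -[RHS](bE q); apply: eq_bigr => j _; rewrite mulrC.
by apply/imfsetP; exists q.
Qed.

End Configuration.
End Limits.

(** * Skew sets, cubes and the Hausdorff distance *)

(** If [K] were infinite, the sets containing all but finitely many points of
[K] would form a proper filter, clustering at some [p]; but the ball of radius
[s / 2] around [p] contains at most one point of [K]. *)
Lemma compact_separated_finite (R : realType) (X : metricType R)
    (K : set X) (s : R) :
  compact K -> 0 < s ->
  (forall x y, K x -> K y -> x != y -> s <= mdist x y) -> finite_set K.
Proof.
move=> cK s0 sep; apply: contrapT => Kinf.
pose cofin : set_system X := [set B | finite_set (K `\` B)].
have cofinP : ProperFilter cofin.
  split; first by rewrite /cofin /= setD0.
  split; first by rewrite /cofin /= setDT.
    by move=> A B fA fB; rewrite /cofin /= setDIr finite_setU.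
  by move=> A B AB; apply: sub_finite_set; exact: setDS.
have cofinK : cofin K by rewrite /cofin /= setDv.
have [p [Kp clp]] := cK cofin cofinP cofinK.
pose V := ball p (s / 2).
have finV : finite_set (K `&` V).
  have [->//|/set0P[x [Kx Vx]]] := eqVneq (K `&` V) set0.
  apply: (@sub_finite_set _ _ [set x]) => // y [Ky Vy].
  apply/eqP/negPn/negP => yx; have := sep _ _ Ky Kx yx.
  have := metric_triangle y p x; move: Vx Vy.
  rewrite /V ballEmdist /= (metric_sym p y) => px py tri sxy.
  lra.
have s20 : 0 < s / 2 by lra.
have [|x [[Kx /(_ _)/= nV] Vx]] := clp (K `\` V) V _ (nbhsx_ballx p _ s20).
  by rewrite /cofin /= setDD.
exact: nV Vx.
Qed.

Section Main.
Context {R : realType} {N : nat}.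

Lemma skew_separation (F : set (l1 R N)) : skew_set F ->
  exists2 s : R, 0 < s & forall (a b : 'rV[R]_N) k, F a -> F b -> a != b ->
    s <= `|a 0 k - b 0 k|.
Proof.
rewrite /skew_set => sk0.
have sk a b k : F a -> F b -> a != b -> (skewness F <= `|a 0 k - b 0 k|%:E)%E.
  by move=> Fa Fb ab; apply: ereal_inf_lbound; exists a, b, k.
case: (skewness F) sk0 sk => [s|_|//].
  by rewrite lte_fin => s0 sk; exists s.
move=> sk; exists 1 => // a b k Fa Fb ab.
by have := sk a b k Fa Fb ab; rewrite leye_eq.
Qed.

Lemma coord_le_d1 (x y : 'rV[R]_N) k : `|x 0 k - y 0 k| <= d1 x y.
Proof. by rewrite /d1 (bigD1 k)//= lerDl sumr_ge0. Qed.

Lemma skew_compact_finite (F : Cmp (l1 R N)) : skew_set F -> finite_set F.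
Proof.
move=> /skew_separation[s s0 sep].
apply: (compact_separated_finite (@Cmp_compact _ _ F) s0) => x y Fx Fy xy.
have [k _] : exists k, (x : 'rV[R]_N) 0 k != (y : 'rV[R]_N) 0 k.
  apply/existsP; apply: contraNT xy => /existsPn xy.
  by apply/eqP/rowP => k; apply/eqP/negPn.
exact: le_trans (sep _ _ k Fx Fy xy) (coord_le_d1 _ _ k).
Qed.

(** For [mdist F K > 0] the bound is strictly above the infimum that defines the
distance from [x] to [K]; for [mdist F K = 0] the two sets coincide. *)
Lemma hausdorff_nearest (X : metricType R) (F K : Cmp X) (x : X) :
  Cmp_set F x ->
  exists2 y, Cmp_set K y & mdist x y <= 2 * mdist F K.
Proof.
move=> Fx; have [FK0|FK0] := eqVneq (mdist F K) 0.
  exists x; first by rewrite -(mdist_positivity _ _ FK0).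
  by rewrite FK0 mulr0 mdistxx.
apply: contrapT => noy.
have FKpos : 0 < mdist F K by rewrite lt_neqAle eq_sym FK0 mdist_ge0.
have : 2 * mdist F K <= mdist F K.
  apply: le_trans (dist_to_le_hausdorff K Fx).
  apply: le_dist_to; first exact: Cmp_neq0.
  move=> b Kb; rewrite leNgt; apply/negP => xb.
  by apply: noy; exists b => //; exact: ltW.
lra.
Qed.

Lemma hausdorff_sub_cubes (F K : Cmp (l1 R N)) (r : R) :
  mdist F K < r -> (K : set (l1 R N)) `<=` cubes F r.
Proof.
move=> FKr x Kx; apply: contrapT => xF.
have : r <= mdist F K.
  rewrite metric_sym; apply: le_trans (dist_to_le_hausdorff F Kx).
  apply: le_dist_to; first exact: Cmp_neq0.
  move=> p Fp; rewrite leNgt; apply/negP => xp; apply: xF.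
  exists p => // k; rewrite -ler_distl.
  exact: le_trans (coord_le_d1 _ _ k) (ltW xp).
by rewrite leNgt FKr.
Qed.

Lemma cvg_mdist0 (X : metricType R) (x : X) : mdist x y @[y --> x] --> (0 : R).
Proof.
apply/cvgrPdist_lt => e e0; apply: filterS (nbhsx_ballx x e e0) => y.
by rewrite ballEmdist /= sub0r normrN ger0_norm ?mdist_ge0.
Qed.

End Main.

Theorem theorem6p4 (R : realType) (N : nat) (F : Cmp (l1 R N)) :
  skew_set F ->
  [/\ finite_set F,
      mag (cubes F r) @[r --> 0^'+] --> mag F
    & {for F, continuous (fun K : Cmp (l1 R N) => mag K)}].
Proof.
move=> skewF; have finF := skew_compact_finite skewF.
have [s s0 sep] := skew_separation skewF.
pose F0 := fset_set (F : set (l1 R N)).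
have F0E : [set` F0] = F by exact: fset_setK.
pose p (q : F0) : 'rV[R]_N := val q.
have p_inj : injective p by exact: val_inj.
have pF q : Cmp_set F (p q) by rewrite -F0E; exact: fsvalP.
have F0p : [fset p q | q : F0]%fset = F0.
  apply/fsetP => x; apply/imfsetP/idP => [[q _ ->]|xF]; first exact: fsvalP.
  by exists [` xF]%fset.
have magF : mag F = fmag F0 by rewrite -F0E mag_finite.
have cubesE r : cubes F r = \bigcup_q cube (p q) r.
  apply/seteqP; split=> x [q Fq xq].
    have qF : q \in F0 by have := Fq; rewrite -F0E.
    by exists [` qF]%fset.
  by exists (p q).
have [|U cvgU bndU] := fmag_cubes_bound p_inj s0.
  by move=> q q' k qq'; apply: sep => //; rewrite (inj_eq p_inj).
rewrite [X in fmag X]F0p -magF in cvgU.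
have bnd : \forall r \near 0^'+, forall G : {fset l1 R N},
    [set` G] `<=` cubes F r -> fmag G <= U r.
  by apply: filterS bndU => r; rewrite cubesE.
split=> //.
  apply: squeeze_cvgr cvgU; last exact: (cvg_cst (mag F)).
  near=> r.
  have r0 : 0 < r by near: r; exact: nbhs_right_gt.
  have br : forall G : {fset l1 R N}, [set` G] `<=` cubes F r -> fmag G <= U r.
    by near: r.
  apply/andP; split; last exact: mag_le.
  rewrite magF (fmag_le_mag br)// F0E => x Fx.
  by exists x => // k; rewrite !(lerBlDr, lerDl) ltW.
apply/(@cvgrPdist_lt R R^o _ (nbhs F) (nbhs_filter F)) => e e0.
have [p' p'P] := choice (fun Kq : Cmp (l1 R N) * F0 =>
  let: ex_intro2 y Ky yq := hausdorff_nearest Kq.1 (pF Kq.2) in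
  ex_intro (fun y =>
    Cmp_set Kq.1 y /\ mdist (p Kq.2 : l1 R N) y <= 2 * mdist F Kq.1) y
    (conj Ky yq)).
have [|L cvgL LG] := @fmag_lower R N F0 p p_inj _ (nbhs F) _
    (fun K q => p' (K, q)).
  move=> q; apply: (@squeeze_cvgr _ _ _ _ (fun=> 0) (fun K => 2 * mdist F K)).
  - near=> K; apply/andP; split; last exact: (p'P (K, q)).2.
    by rewrite /d1 sumr_ge0.
  - exact: cvg_cst.
  - rewrite -[X in _ --> X](mulr0 2); apply: cvgM; first exact: cvg_cst.
    exact: cvg_mdist0.
rewrite [X in fmag X]F0p -magF in cvgL.
have [r [r0 br Ur]] : exists r, [/\ 0 < r, forall G : {fset l1 R N},
    [set` G] `<=` cubes F r -> fmag G <= U r & `|mag F - U r| < e].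
  near ((0 : R)^'+) => r; exists r; split.
  - by near: r; exact: nbhs_right_gt.
  - by near: r.
  - by near: r; move/cvgrPdist_lt : cvgU; apply.
near=> K.
have FKr : mdist F K < r.
  by near: K; have := nbhsx_ballx F r r0; rewrite ballEmdist.
have bK (G : {fset l1 R N}) : [set` G] `<=` (K : set (l1 R N)) -> fmag G <= U r.
  by move=> GK; apply: br; exact: subset_trans (hausdorff_sub_cubes FKr).
have KU : mag K <= U r by exact: mag_le.
have LK : L K <= mag K.
  have [G Gp' <-] : exists2 G : {fset l1 R N},
      (forall y, y \in G -> exists q, y = p' (K, q)) & fmag G = L K.
    by near: K.
  apply: (fmag_le_mag bK) => y /Gp'[q ->]; exact: (p'P (K, q)).1.
have : `|mag F - L K| < e by near: K; move/cvgrPdist_lt : cvgL; apply.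
move: Ur; rewrite !ltr_norml => /andP[? ?] /andP[? ?].
by apply/andP; split; lra.
Unshelve. all: by end_near. Qed.
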